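(* Let $P$ be a finite poset, $\mathbb{K}$ a field of characteristic zero, $C\in\mathbb{K}$ a generic constant, and $v\in P$. Let $v_1,\dots,v_k$ be the elements of $P$ covered by $v$ and set $T_v^*=\tau_{v_1}\tau_{v_2}\cdots\tau_{v_k}\tau_v\tau_{v_k}\cdots\tau_{v_2}\tau_{v_1}$ (so $T_v^*=\tau_v$ if $v$ is minimal). Then $\Theta\circ\Delta^{-1}\circ T_v^*=T_v\circ\Theta\circ\Delta^{-1}$ on the domains where these maps are defined.
   Context: $\mathbb{K}^P$ is the set of labelings $f:P\to\mathbb{K}$; all maps are birational maps $\mathbb{K}^P\dashrightarrow\mathbb{K}^P$ and products denote composition, rightmost first. $\widehat P$ is $P$ with a new minimum $\widehat0$ and maximum $\widehat1$; $x\lessdot y$ means $y$ covers $x$ in $\widehat P$. Birational order toggle: $T_v$ changes only the label at $v$: $(T_vf)(v)=\dfrac{\sum_{y\in\widehat P,\,y\lessdot v}f(y)}{f(v)\sum_{y\in\widehat P,\,y\gtrdot v}1/f(y)}$, with $f(\widehat0)=1$, $f(\widehat1)=C$. Birational antichain toggle: $\tau_v$ changes only the label at $v$: $(\tau_vg)(v)=C/\sum g(y_1)\cdots g(y_k)$, the sum over all maximal chains $(y_1,\dots,y_k)$ of $P$ containing $v$. $(\Theta f)(x)=C/f(x)$; $(\Delta^{-1}f)(x)=\sum f(y_1)\cdots f(y_k)$ over all chains $x=y_1\lessdot y_2\lessdot\cdots\lessdot y_k\lessdot\widehat1$ in $\widehat P$. *)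

(* Defs.v *)
From HB Require Import structures.
From mathcomp Require Import all_boot all_order all_algebra.

Set Implicit Arguments.
Unset Strict Implicit.
Unset Printing Implicit Defensive.

Import Order.TTheory GRing.Theory.
Local Open Scope ring_scope.

Definition covered_by (d : Order.disp_t) (T : finPOrderType d) : rel T :=
  fun x y => (x < y)%O && [forall z, ~~ ((x < z)%O && (z < y)%O)].

Definition is_chain (d : Order.disp_t) (T : finPOrderType d) (A : {set T}) :
  bool := [forall x in A, forall y in A, (x >=< y)%O].

Definition maximal_chain (d : Order.disp_t) (T : finPOrderType d) :
  pred {set T} := maxset (@is_chain d T).

Inductive hat (T : Type) : Type := hat0 | hatE of T | hat1.
Arguments hat0 {T}.
Arguments hat1 {T}.

Definition hat_to_option (T : Type) (a : hat T) : option (option T) :=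
  match a with hat0 => None | hat1 => Some None | hatE x => Some (Some x) end.

Definition option_to_hat (T : Type) (a : option (option T)) : hat T :=
  match a with None => hat0 | Some None => hat1 | Some (Some x) => hatE x end.

Lemma hat_to_optionK (T : Type) :
  cancel (@hat_to_option T) (@option_to_hat T).
Proof. by case. Qed.

HB.instance Definition _ (T : eqType) :=
  Equality.copy (hat T) (can_type (@hat_to_optionK T)).
HB.instance Definition _ (T : choiceType) :=
  Choice.copy (hat T) (can_type (@hat_to_optionK T)).
HB.instance Definition _ (T : countType) :=
  Countable.copy (hat T) (can_type (@hat_to_optionK T)).
HB.instance Definition _ (T : finType) :=
  Finite.copy (hat T) (can_type (@hat_to_optionK T)).

Section HatOrder.
Variables (d : Order.disp_t) (P : porderType d).

Definition hat_le (a b : hat P) : bool :=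
  match a, b with
  | hat0, _ => true
  | _, hat1 => true
  | hatE x, hatE y => (x <= y)%O
  | _, _ => false
  end.

Definition hat_lt (a b : hat P) : bool := (b != a) && hat_le a b.

Fact hat_lt_def (a b : hat P) : hat_lt a b = (b != a) && hat_le a b.
Proof. by []. Qed.

Fact hat_le_refl : reflexive hat_le.
Proof. by case=> //= x; apply: lexx. Qed.

Fact hat_le_anti : antisymmetric hat_le.
Proof. by case=> [|x|] [|y|] //= /le_anti ->. Qed.

Fact hat_le_trans : transitive hat_le.
Proof. by case=> [|y|] [|x|] [|z|] //=; apply: le_trans. Qed.

HB.instance Definition _ := Order.isPOrder.Build d (hat P)
  hat_lt_def hat_le_refl hat_le_anti hat_le_trans.

End HatOrder.

HB.instance Definition _ (d : Order.disp_t) (P : finPOrderType d) :=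
  Finite.on (hat P).

(** A rational map K^P --> K^P is represented as a partial function, equal to
    [None] exactly where a denominator in its defining formula vanishes.  A
    composite (by [pcomp], rightmost factor first) is defined only where every
    intermediate value is. *)

Definition labeling (P : finType) (K : Type) : Type := {ffun P -> K}.

Definition rmap (P : finType) (K : Type) : Type :=
  labeling P K -> option (labeling P K).

Definition rmap_prod (P : finType) (K : Type) (Fs : seq (rmap P K)) :
  rmap P K := foldr (fun F G : rmap P K => pcomp F G) Some Fs.

Definition agree_on_domains (P : finType) (K : Type) (F G : rmap P K) : Prop :=
  forall f h1 h2, F f = Some h1 -> G f = Some h2 -> h1 = h2.

Definition relabel (P : finType) (K : Type) (f : labeling P K) (v : P) (a : K) :
  labeling P K := [ffun x => if x == v then a else f x].

Section Toggles.
Variables (d : Order.disp_t) (P : finPOrderType d) (K : fieldType) (C : K).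

Definition hat_label (f : labeling P K) (a : hat P) : K :=
  match a with hat0 => 1 | hatE x => f x | hat1 => C end.

Definition order_toggle (v : P) : rmap P K := fun f =>
  let num := \sum_(y : hat P | covered_by y (hatE v)) hat_label f y in
  let den := f v * \sum_(y : hat P | covered_by (hatE v) y)
                      (hat_label f y)^-1 in
  if [forall (y : hat P | covered_by (hatE v) y), hat_label f y != 0]
     && (den != 0)
  then Some (relabel f v (num / den)) else None.

Definition antichain_toggle (v : P) : rmap P K := fun g =>
  let den := \sum_(A : {set P} | maximal_chain A && (v \in A))
                \prod_(y in A) g y in
  if den != 0 then Some (relabel g v (C / den)) else None.

Definition Theta : rmap P K := fun f =>
  if [forall x, f x != 0] then Some [ffun x => C / f x] else None.

(** The chain x = y_1 <. y_2 <. ... <. y_k <. 1 of [hat P] is given by its tail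
    [s = (y_2, ..., y_k)]; the bound [size s <= #|P|] excludes no chain. *)
Definition Delta_inv : rmap P K := fun f =>
  Some [ffun x => \sum_(s : #|P|.-bseq P |
          path (@covered_by d (hat P)) (hatE x) (rcons (map (@hatE P) s) hat1))
        \prod_(y <- x :: s) f y].

Definition Tstar (v : P) (vs : seq P) : rmap P K :=
  rmap_prod [seq antichain_toggle u | u <- vs ++ v :: rev vs].

End Toggles.

(* Main.v *)
(** Summing over the maximal chains of a subset instead of over saturated paths,
    the sum over maximal chains through [v] factors as W(v) D(v), where
    D = Delta^{-1} g satisfies D(x) = g(x) * sum of D over the upper covers of x
    (counting D = 1 at the added maximum), and W(v), the sum over chains strictly
    below [v], satisfies the dual recursion.  The elements v_i covered by [v]
    form an antichain, so their toggles do not interact.  The first round makes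
    g(v_i) W(v_i) = C / D(v_i), so toggling [v] divides C by
    (sum_i C / D(v_i)) D(v); the second round brings D(v_i) back to its original
    value, so D changes only at [v], exactly as the order toggle prescribes. *)

Require Import Defs.
From mathcomp Require Import all_boot all_order all_algebra.
From mathcomp Require Import ring.

Import Order.TTheory GRing.Theory.
Local Open Scope ring_scope.

(** * Weighted sums over the maximal cliques of a symmetric relation *)

Section MaxChainSum.
Variables (T : finType) (K : comNzRingType) (c : rel T).
Hypotheses (c_refl : reflexive c) (c_sym : symmetric c).
Implicit Types (f : T -> K) (X Y A B Q : {set T}) (m x y z : T).

(** These are the maximal cliques of [c] inside [X]. Letting [X] be any subset is what allows sums
    over chains to be localized and factored. *)
Definition max_chain_in X A : bool :=
  [&& A \subset X, [forall x in A, forall y in A, c x y]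
    & [forall z in X, [forall a in A, c z a] ==> (z \in A)]].

Definition chain_sum f X : K :=
  \sum_(A : {set T} | max_chain_in X A) \prod_(y in A) f y.

Lemma max_chain_inP X A :
  reflect [/\ {subset A <= X}, {in A &, forall x y, c x y}
            & forall z, z \in X -> {in A, forall a, c z a} -> z \in A]
          (max_chain_in X A).
Proof.
apply: (iffP and3P) => [[/subsetP sAX /forall_inP cA /forall_inP mA]|[sAX cA mA]].
  split=> // [x y xA yA|z zX cz].
    by move/forall_inP: (cA x xA); apply.
  by apply: (implyP (mA z zX)); apply/forall_inP.
split; first exact/subsetP.
  by apply/forall_inP=> x xA; apply/forall_inP=> y yA; apply: cA.
by apply/forall_inP=> z zX; apply/implyP=> /forall_inP; apply: mA.
Qed.

Lemma eq_chain_sum f f' X :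
  {in X, f =1 f'} -> chain_sum f X = chain_sum f' X.
Proof.
move=> eqf; apply: eq_bigr => A /max_chain_inP[sAX _ _].
by apply: eq_bigr => y yA; apply/eqf/sAX.
Qed.

Lemma chain_sum0 f : chain_sum f set0 = 1.
Proof.
rewrite /chain_sum (big_pred1 set0) ?big_set0 // => A /=.
apply/max_chain_inP/eqP => [[sA _ _]|->].
  by apply/setP=> x; rewrite inE; apply/negP=> /sA; rewrite inE.
by split=> // x y; rewrite inE.
Qed.

Lemma chain_sum1 f m : chain_sum f [set m] = f m.
Proof.
rewrite /chain_sum (big_pred1 [set m]) ?big_set1 // => A /=.
apply/max_chain_inP/eqP => [[sA _ mA]|->].
  apply/eqP; rewrite eqEsubset; apply/andP; split; first exact/subsetP.
  rewrite sub1set; apply: mA; first by rewrite inE.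
  by move=> a /sA; rewrite inE => /eqP ->.
by split=> // x y; rewrite !inE => /eqP -> /eqP ->.
Qed.

(** Within the neighbourhood of [m] everything is related to [m], so maximality forces [m] into the
    clique. Conversely, whatever is related to a clique containing [m] already lies in that
    neighbourhood. *)
Lemma max_chain_through X m A : m \in X ->
  max_chain_in X A && (m \in A) = max_chain_in [set x in X | c m x] A.
Proof.
move=> mX; apply/andP/max_chain_inP.
  case=> /max_chain_inP[sAX cA mA] Am; split=> // [x xA|z].
    by rewrite inE sAX //= cA.
  by rewrite inE => /andP[zX _]; apply: mA.
case=> sA cA mA.
have Am : m \in A.
  apply: mA => [|a /sA]; first by rewrite inE mX c_refl.
  by rewrite inE => /andP[].
split=> //; apply/max_chain_inP; split=> // [x /sA|z zX cz].
  by rewrite inE => /andP[].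
by apply: mA => //; rewrite inE zX c_sym cz.
Qed.

(** Since all cross pairs are related, a maximal clique of the union is exactly a maximal clique of
    [X] joined to one of [Y], and the product of labels splits accordingly. *)
Lemma chain_sumU f X Y : [disjoint X & Y] -> {in X & Y, forall x y, c x y} ->
  chain_sum f (X :|: Y) = chain_sum f X * chain_sum f Y.
Proof.
move=> dXY cXY.
have dis x : x \in X -> x \in Y -> False.
  by move=> xX xY; move/pred0P: dXY => /(_ x) /=; rewrite xX xY.
rewrite /chain_sum big_distrlr /= pair_big /=.
(* A clique of the union is encoded by its traces on [X] and [Y]. *)
rewrite (reindex_onto (fun p : {set T} * {set T} => p.1 :|: p.2)
                      (fun A => (A :&: X, A :&: Y))) /=; last first.
  move=> A /max_chain_inP[/subsetP sA _ _].
  by rewrite -setIUr; apply/setIidPl.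
apply: eq_big => [[A B]|[A B]] /=; last first.
  case/andP=> _ /eqP[eA eB]; have dAB : [disjoint A & B].
    rewrite -eA -eB; apply/pred0P=> x /=; rewrite !in_setI.
    by apply/negP=> /andP[/andP[_ xX] /andP[_ xY]]; apply: (dis x).
  by rewrite -bigU //; apply: eq_bigl => x; rewrite !inE.
apply/andP/andP => [[/max_chain_inP[sAB cAB mAB] /eqP[eA eB]]|].
  have sA x : x \in A -> x \in X by rewrite -eA in_setI => /andP[].
  have sB x : x \in B -> x \in Y by rewrite -eB in_setI => /andP[].
  split; apply/max_chain_inP; split=> //.
  - by move=> x y xA yA; apply: cAB; rewrite inE ?xA ?yA.
  - move=> z zX cz; rewrite -eA in_setI zX andbT; apply: mAB => [|a].
      by rewrite inE zX.
    by rewrite inE => /orP[/cz //|/sB]; apply: cXY.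
  - by move=> x y xA yA; apply: cAB; rewrite inE ?xA ?yA orbT.
  - move=> z zY cz; rewrite -eB in_setI zY andbT; apply: mAB => [|a].
      by rewrite inE zY orbT.
    by rewrite inE => /orP[/sA aX|/cz //]; rewrite c_sym; apply: cXY.
case=> /max_chain_inP[sA cA mA] /max_chain_inP[sB cB mB]; split.
  apply/max_chain_inP; split.
  - by move=> x; rewrite !inE => /orP[/sA -> //|/sB ->]; rewrite orbT.
  - move=> x y; rewrite !inE => /orP[xA|xB] /orP[yA|yB].
    + exact: cA.
    + by apply: cXY; [apply: sA|apply: sB].
    + by rewrite c_sym; apply: cXY; [apply: sA|apply: sB].
    + exact: cB.
  - move=> z; rewrite !inE => /orP[zX|zY] cz.
      by rewrite mA // => a aA; apply: cz; rewrite inE aA.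
    by rewrite mB ?orbT // => a aA; apply: cz; rewrite inE aA orbT.
apply/eqP; congr pair; apply/setP=> x; rewrite !inE.
  apply/idP/idP=> [/andP[/orP[//|/sB xY] xX]|xA]; first by case: (dis x).
  by rewrite xA sA.
apply/idP/idP=> [/andP[/orP[/sA xX|//] xY]|xB]; first by case: (dis x).
by rewrite xB orbT sB.
Qed.

(** Each maximal clique is counted once, at its unique element in [Q]; exchanging the two sums gives
    the formula. *)
Lemma chain_sum_transversal f X Q : Q \subset X ->
  (forall A, max_chain_in X A -> #|Q :&: A| = 1%N) ->
  chain_sum f X = \sum_(m in Q) chain_sum f [set x in X | c m x].
Proof.
move=> /subsetP sQX Q1.
transitivity (\sum_(m in Q) \sum_(A | max_chain_in X A && (m \in A))
                 \prod_(y in A) f y); last first.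
  apply: eq_bigr => m /sQX mX; apply: eq_bigl => A.
  exact: max_chain_through.
rewrite (exchange_big_dep (max_chain_in X)) /=; last by move=> m A _ /andP[].
apply: eq_bigr => A mA; move/eqP/cards1P: (Q1 A mA) => [m Em].
rewrite [RHS](big_pred1 m) // => x /=.
by rewrite mA /= -in_setI Em inE.
Qed.

(** [r] is either of the two strict orders whose comparability relation is [c],
    so that upper and lower covers are treated at once. *)
Section Covers.
Variable r : rel T.
Hypotheses (r_irr : irreflexive r) (r_trans : transitive r).
Hypothesis cE : forall x y, c x y = [|| x == y, r x y | r y x].

Definition rel_cover : rel T :=
  fun x y => r x y && [forall z, ~~ (r x z && r z y)].

(** The witness has the fewest [r]-predecessors: an element of [A] preceding it would have strictly
    fewer by transitivity. *)
Lemma chain_least A : {in A &, forall x y, c x y} -> A != set0 ->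
  exists2 a, a \in A & {in A, forall b, b != a -> r a b}.
Proof.
move=> cA /set0Pn[a0 Aa0].
case: (arg_minnP (fun a => #|[set b | r b a]|) Aa0) => a Aa amin.
exists a => // b Ab nba; have := cA a b Aa Ab.
rewrite cE eq_sym (negPf nba) /= => /orP[//|rba].
have: [set x | r x b] \proper [set x | r x a].
  apply/properP; split; last by exists b; rewrite inE ?r_irr.
  by apply/subsetP=> x; rewrite !inE => /r_trans; apply.
by move/proper_card; rewrite ltnNge amin.
Qed.

(** The only cover of [v] in [A] is the least element of [A], so the covers form a transversal as
    required by [chain_sum_transversal]. *)
Lemma max_chain_cover v A : max_chain_in [set x | r v x] A ->
  [exists x, r v x] -> #|[set m | rel_cover v m] :&: A| = 1%N.
Proof.
move=> /max_chain_inP[sA cA mA] /existsP[x0 rvx0].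
have nA0 : A != set0.
  apply/negP=> /eqP A0; suff: x0 \in set0 by rewrite inE.
  by rewrite -A0; apply: mA => [|a]; rewrite ?A0 inE.
have [a Aa amin] := chain_least A cA nA0.
apply/eqP/cards1P; exists a; apply/setP=> m; rewrite !inE.
have rva : r v a by have := sA a Aa; rewrite inE.
apply/idP/eqP => [/andP[/andP[rvm /forallP covm] Am]|->].
  apply/eqP/negP=> /negP nma; have := covm a.
  by rewrite rva amin.
(* An element strictly between [v] and [a] would precede all of [A], hence belong to [A] by
   maximality, against the choice of [a]. *)
rewrite Aa andbT /rel_cover rva /=; apply/forallP=> z.
apply/negP=> /andP[rvz rza].
have Az : z \in A.
  apply: mA; first by rewrite inE.
  move=> b Ab; rewrite cE; case: (eqVneq b a) => [->|nba].
    by rewrite rza orbT.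
  by rewrite (r_trans _ _ _ rza (amin b Ab nba)) orbT.
have nza : z != a by apply: contraTneq rza => ->; rewrite r_irr.
by have := r_trans _ _ _ rza (amin z Az nza); rewrite r_irr.
Qed.

(** Chains beyond [v] are sorted by the cover [m] of [v] that they contain. As nothing lies between
    [v] and [m], the elements beyond [v] comparable to [m] are [m] and those beyond [m]. The boolean
    term is the empty chain, present only when nothing is beyond [v]. *)
Lemma chain_sum_rel f v : chain_sum f [set x | r v x] =
  [forall x, ~~ r v x]%:R
  + \sum_(m | rel_cover v m) f m * chain_sum f [set x | r m x].
Proof.
have [noneP|] := boolP [forall x, ~~ r v x].
  have none x : r v x = false by apply/negbTE/(forallP noneP).
  rewrite big_pred0 => [|m]; last by rewrite /rel_cover none.
  rewrite addr0 -(chain_sum0 f); congr chain_sum.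
  by apply/setP=> x; rewrite !inE none.
rewrite negb_forall => /existsP[x0]; rewrite negbK => rvx0; rewrite add0r.
rewrite (chain_sum_transversal f _ [set m | rel_cover v m]); first last.
- by move=> A mA; apply: max_chain_cover => //; apply/existsP; exists x0.
- by apply/subsetP=> m; rewrite !inE => /andP[].
apply: eq_big => [m|m]; rewrite inE // => /andP[rvm /forallP covm].
rewrite -(chain_sum1 f m) -chain_sumU.
- congr chain_sum; apply/setP=> x; rewrite !inE cE eq_sym.
  have [->|nxm] := eqVneq x m; first by rewrite rvm.
  have := covm x; case rmx: (r m x) => /=; first by rewrite (r_trans _ _ _ rvm).
  by case: (r v x) => //= /negPf.
- by apply/pred0P=> x /=; rewrite !inE; case: eqP => // ->; rewrite r_irr.
- by move=> x y; rewrite !inE => /eqP -> rmy; rewrite cE rmy orbT.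
Qed.

(** The elements comparable to [v] form three blocks, before [v], [v] itself and after [v], with all
    cross pairs comparable; [chain_sumU] applies twice. *)
Lemma chain_sum_through f v :
  \sum_(A | max_chain_in setT A && (v \in A)) \prod_(y in A) f y =
  chain_sum f [set x | r x v] * (f v * chain_sum f [set x | r v x]).
Proof.
rewrite -(chain_sum1 f v) -!chain_sumU.
- apply: eq_bigl => A; rewrite max_chain_through ?inE //; congr max_chain_in.
  apply/setP=> x; rewrite !inE cE eq_sym.
  by case: (x == v); case: (r v x); case: (r x v).
- apply/pred0P=> x /=; rewrite !inE; case: eqP => [->|_]; first by rewrite r_irr.
  by apply/negP=> /andP[rxv /(r_trans _ _ _ rxv)]; rewrite r_irr.
- move=> x y; rewrite !inE => rxv /orP[/eqP ->|rvy]; rewrite cE ?rxv ?orbT //.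
  by rewrite (r_trans _ _ _ rxv rvy) orbT.
- by apply/pred0P=> x /=; rewrite !inE; case: eqP => // ->; rewrite r_irr.
- by move=> x y; rewrite !inE => /eqP -> rmy; rewrite cE rmy orbT.
Qed.

End Covers.
End MaxChainSum.

(** * Comparability in [P] and covers in the extended poset *)

Section Poset.
Variables (d : Order.disp_t) (P : finPOrderType d).
Implicit Types (x y u v : P).

Lemma comparable_ltVgt x y : (x >=< y)%O = [|| x == y, (x < y)%O | (y < x)%O].
Proof.
by rewrite /Order.comparable !le_eqVlt (eq_sym y x); case: eqP.
Qed.

Lemma comparable_symmetric : symmetric (>=<%O : rel P).
Proof. by move=> x y; rewrite comparable_sym. Qed.

Lemma maximal_chainE (A : {set P}) :
  maximal_chain A = max_chain_in P >=<%O setT A.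
Proof.
apply/maxsetP/max_chain_inP => [[cA mA]|[_ cA mA]].
  have cA2 : {in A &, forall x y, (x >=< y)%O}.
    by move=> x y xA yA; move/forall_inP: cA => /(_ x xA)/forall_inP; apply.
  split=> // z _ cz; rewrite -(mA (z |: A)) ?setU11 ?subsetUr //.
  apply/forall_inP=> x; rewrite !inE => /orP[/eqP ->|xA];
    apply/forall_inP=> y; rewrite !inE => /orP[/eqP ->|yA].
  - exact: comparablexx.
  - exact: cz.
  - by rewrite comparable_sym; apply: cz.
  - exact: cA2.
split=> [|B cB sAB].
  by apply/forall_inP=> x xA; apply/forall_inP=> y yA; apply: cA.
apply/eqP; rewrite eqEsubset sAB andbT; apply/subsetP=> x xB.
apply: mA => // a /(subsetP sAB) aB.
by move/forall_inP: cB => /(_ x xB)/forall_inP; apply.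
Qed.


Lemma lt_hatE x y : (hatE x < hatE y)%O = (x < y)%O.
Proof. by rewrite !lt_def; congr (_ && _). Qed.

Lemma covered_by_hatE x y : covered_by (hatE x) (hatE y) = covered_by x y.
Proof.
rewrite /covered_by lt_hatE; congr (_ && _).
apply/forallP/forallP => H => [z|[|z|]] //.
  by have := H (hatE z); rewrite !lt_hatE.
by rewrite !lt_hatE; apply: H.
Qed.

Lemma covered_by_hat1 x : covered_by (hatE x) hat1 = [forall z, ~~ (x < z)%O].
Proof.
rewrite /covered_by /=; apply/forallP/forallP => H => [z|[|z|]] //.
  by have := H (hatE z); rewrite !lt_hatE andbT.
by rewrite !lt_hatE andbT; apply: H.
Qed.

Lemma covered_by_hat0 x : covered_by hat0 (hatE x) = [forall z, ~~ (z < x)%O].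
Proof.
rewrite /covered_by /=; apply/forallP/forallP => H => [z|[|z|]] //.
  by have := H (hatE z); rewrite !lt_hatE.
by rewrite !lt_hatE; apply: H.
Qed.

Lemma big_hat (V : nmodType) (F : hat P -> V) :
  \sum_y F y = F hat0 + F hat1 + \sum_x F (hatE x).
Proof.
rewrite (bigD1 hat0) // (bigD1 hat1) //= -addrA; congr (_ + (_ + _)).
rewrite (reindex_omap (@hatE P)
  (fun a => if a is hatE x then Some x else None)) /=; last by case.
by apply: eq_bigl => x; rewrite eqxx.
Qed.

Lemma sum_upper_covers (V : nmodType) (F : hat P -> V) x :
  \sum_(y | covered_by (hatE x) y) F y =
  (if [forall z, ~~ (x < z)%O] then F hat1 else 0)
  + \sum_(y | covered_by x y) F (hatE y).
Proof.
rewrite big_mkcond big_hat /= add0r covered_by_hat1 [in RHS]big_mkcond /=.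
by congr (_ + _); apply: eq_bigr => y _; rewrite covered_by_hatE.
Qed.

Lemma sum_lower_covers (V : nmodType) (F : hat P -> V) x :
  \sum_(y | covered_by y (hatE x)) F y =
  (if [forall z, ~~ (z < x)%O] then F hat0 else 0)
  + \sum_(y | covered_by y x) F (hatE y).
Proof.
rewrite big_mkcond big_hat /= covered_by_hat0 [in RHS]big_mkcond /=.
rewrite addr0.
by congr (_ + _); apply: eq_bigr => y _; rewrite covered_by_hatE.
Qed.

(** * Chain sums above and below an element, and their recursions *)

Section Labels.
Variables (K : fieldType) (C : K).
Implicit Types (f g : labeling P K).

Definition up_sum f x : K := chain_sum P K >=<%O f [set y | (x < y)%O].
Definition down_sum f x : K := chain_sum P K >=<%O f [set y | (y < x)%O].

Lemma up_sum_rec f x : up_sum f x =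
  [forall z, ~~ (x < z)%O]%:R + \sum_(y | covered_by x y) f y * up_sum f y.
Proof.
exact: (chain_sum_rel P K >=<%O (@comparablexx _ P) comparable_symmetric
  <%O (@ltxx _ P) (@lt_trans _ P) comparable_ltVgt f x).
Qed.

Lemma down_sum_rec f x : down_sum f x =
  [forall z, ~~ (z < x)%O]%:R + \sum_(y | covered_by y x) f y * down_sum f y.
Proof.
rewrite /down_sum (chain_sum_rel P K >=<%O (@comparablexx _ P)
  comparable_symmetric (fun y z => (z < y)%O)) //.
- congr (_ + _); apply: eq_bigl => y; rewrite /covered_by /rel_cover.
  by congr (_ && _); apply: eq_forallb => z; rewrite andbC.
- by move=> y z t zy yt; apply: lt_trans yt zy.
- by move=> y z; rewrite comparable_ltVgt [(y < z)%O || _]orbC.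
Qed.

Lemma eq_up_sum f g x : (forall y, (x < y)%O -> f y = g y) ->
  up_sum f x = up_sum g x.
Proof. by move=> E; apply: eq_chain_sum => y; rewrite inE; apply: E. Qed.

Lemma eq_down_sum f g x : (forall y, (y < x)%O -> f y = g y) ->
  down_sum f x = down_sum g x.
Proof. by move=> E; apply: eq_chain_sum => y; rewrite inE; apply: E. Qed.

Lemma maximal_chain_sum f v :
  \sum_(A : {set P} | maximal_chain A && (v \in A)) \prod_(y in A) f y =
  down_sum f v * (f v * up_sum f v).
Proof.
rewrite -(chain_sum_through P K >=<%O (@comparablexx _ P)
  comparable_symmetric <%O (@ltxx _ P) (@lt_trans _ P) comparable_ltVgt).
by apply: eq_bigl => A; rewrite maximal_chainE.
Qed.

(** Induction from the top of [P] downwards, on the number of elements above [x]. *)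
Lemma gt_ind (Q : P -> Prop) :
  (forall x, (forall y, (x < y)%O -> Q y) -> Q x) -> forall x, Q x.
Proof.
move=> IH x; have [n] := ubnP #|[set y | (x < y)%O]|.
elim: n x => // n IHn x lt_n; apply: IH => y xy; apply: IHn.
rewrite -ltnS; apply: leq_trans lt_n; rewrite ltnS; apply: proper_card.
apply/properP; split; last by exists y; rewrite inE ?ltxx.
by apply/subsetP=> z; rewrite !inE; apply: lt_trans.
Qed.

(** * From saturated paths to maximal chains in [Delta_inv] *)

Definition up_chain x : pred (seq P) := fun s =>
  path (@covered_by d (hat P)) (hatE x) (rcons (map (@hatE P) s) hat1).

Lemma up_chain_nil x : up_chain x [::] = [forall z, ~~ (x < z)%O].
Proof. by rewrite /up_chain /= covered_by_hat1 andbT. Qed.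

Lemma up_chain_cons x y s :
  up_chain x (y :: s) = covered_by x y && up_chain y s.
Proof. by rewrite /up_chain /= covered_by_hatE. Qed.

(** The inequality is strict because [x] is a further element distinct from those of [s]; this
    leaves room to prepend one element within the bound [#|P|]. *)
Lemma size_up_chain x s : up_chain x s -> (size s < #|P|)%N.
Proof.
move=> us; have: path <%O x s.
  elim: s x us => //= y s IHs x; rewrite up_chain_cons.
  by case/andP=> /andP[-> _] /IHs.
by move/(@lt_sorted_uniq _ _ (x :: s))/card_uniqP=> /= <-; apply: max_card.
Qed.

Definition path_sum f x : K :=
  \sum_(s : #|P|.-bseq P | up_chain x s) \prod_(y <- x :: s) f y.

Lemma path_sum_rec f x : path_sum f x =
  f x * ([forall z, ~~ (x < z)%O]%:R + \sum_(y | covered_by x y) path_sum f y).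
Proof.
(* Paths are sorted by their first step; the default [hat1] of [head] is the correct step for an
   empty tail. *)
rewrite /path_sum (partition_big
  (fun s : #|P|.-bseq P => head hat1 (map (@hatE P) s))
  (covered_by (hatE x))) /=; last first.
  case=> [[|y s] /= sz].
    by rewrite up_chain_nil covered_by_hat1.
  by rewrite up_chain_cons covered_by_hatE => /andP[].
rewrite sum_upper_covers mulrDr; congr (_ + _).
  case: ifP => [mx|_]; last by rewrite mulr0.
  rewrite (big_pred1 [bseq]) ?big_seq1 ?mulr1 // => -[[|y s] sz] /=.
    by rewrite up_chain_nil mx !eqxx.
  by rewrite andbF.
rewrite mulr_sumr; apply: eq_bigr => y xy.
(* If [y :: s] is too long, [insub_bseq] returns the empty sequence, whose head is not [y]; by
   [size_up_chain] such an [s] contributes nothing on the other side either. *)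
rewrite (reindex_onto (fun s : #|P|.-bseq P => insub_bseq #|P| (y :: s))
          (fun s : #|P|.-bseq P => insub_bseq #|P| (behead s))) /=; last first.
  case=> [[|z s] /= sz] /andP[_ /eqP //[->]].
  by apply/val_inj; rewrite /insub_bseq /= !val_insubd /= (ltnW sz) sz.
rewrite mulr_sumr; apply: eq_big => [s|s].
  rewrite /insub_bseq !val_insubd /=.
  case: (ltnP (size s) #|P|) => [lt_s|ge_s] /=.
    rewrite up_chain_cons xy /= eqxx andbT.
    rewrite -[RHS]andbT; congr (_ && _); apply/eqP/val_inj.
    by rewrite /= val_insubd size_bseq.
  by rewrite andbF; apply/esym/negP => /size_up_chain; rewrite ltnNge ge_s.
move=> /andP[/andP[_ E] _]; move: E.
rewrite /insub_bseq !val_insubd /=; case: ifP => //= _ _.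
by rewrite !big_cons mulrA.
Qed.

(** The path sum and [f x * up_sum f x] obey the same recursion over upper covers, so they agree by
    descending induction. *)
Lemma Delta_invE f : Delta_inv f = Some [ffun x => f x * up_sum f x].
Proof.
congr Some; apply/ffunP=> x; rewrite !ffunE -/(path_sum f x).
elim/gt_ind: x => x IH; rewrite path_sum_rec up_sum_rec; congr (_ * (_ + _)).
by apply: eq_bigr => y /andP[/IH].
Qed.

(** * Effect of antichain toggles on the chain sums *)

Definition chain_weight f u : K := down_sum f u * (f u * up_sum f u).

Lemma antichain_toggleE u f h : antichain_toggle C u f = Some h ->
  chain_weight f u != 0 /\ h = relabel f u (C / chain_weight f u).
Proof.
by rewrite /antichain_toggle maximal_chain_sum; case: ifP => // nz [<-].
Qed.

Lemma pcomp_SomeP (F G : rmap P K) f h :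
  pcomp F G f = Some h -> exists2 k, G f = Some k & F k = Some h.
Proof. by rewrite /pcomp; case: (G f) => //= k; exists k. Qed.

Lemma rmap_prod_cat (Fs Gs : seq (rmap P K)) f :
  rmap_prod (Fs ++ Gs) f = pcomp (rmap_prod Fs) (rmap_prod Gs) f.
Proof.
elim: Fs => [|F Fs IH] /=; first by rewrite /pcomp; case: rmap_prod.
by rewrite /pcomp IH /pcomp; case: (rmap_prod Gs f).
Qed.

(** The weight at [u] involves only [u] and elements comparable to it, none of which is another
    member of [us]. Hence every toggle sees the weight of the initial labeling, whatever the
    order. *)
Lemma toggle_antichain us f h : uniq us ->
    {in us &, forall x y, ~~ (x < y)%O} ->
    rmap_prod [seq antichain_toggle C u | u <- us] f = Some h ->
  (forall x, x \notin us -> h x = f x) /\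
  (forall x, x \in us ->
     chain_weight f x != 0 /\ h x = C / chain_weight f x).
Proof.
elim: us h => [|u us IH] h /=; first by move=> _ _ [<-]; split.
case/andP=> u_us uniq_us anti; rewrite {1}/pcomp.
case E: (rmap_prod _ f) => [k|//] /= /antichain_toggleE[nz ->].
have [] := IH k uniq_us _ E => [x y xus yus|kN kE].
  by apply: anti; rewrite inE ?xus ?yus orbT.
have wE : chain_weight k u = chain_weight f u.
  rewrite /chain_weight kN //; congr (_ * (_ * _)).
    apply: eq_down_sum => y yu; apply: kN; apply: contraL yu => yus.
    by apply: anti; rewrite inE ?yus ?eqxx ?orbT.
  apply: eq_up_sum => y yu; apply: kN; apply: contraL yu => yus.
  by apply: anti; rewrite inE ?yus ?eqxx ?orbT.
split=> x; rewrite inE ffunE.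
  by rewrite negb_or => /andP[/negPf -> /kN].
case: eqVneq => [->|_] /=; first by rewrite -wE.
exact: kE.
Qed.

Lemma Tstar_up_sum v vs g h : C != 0 -> uniq vs ->
    (forall u, (u \in vs) = covered_by u v) -> Tstar C v vs g = Some h ->
  let W := [forall z, ~~ (z < v)%O]%:R
           + \sum_(u | covered_by u v) C / (g u * up_sum g u) in
  [/\ W * (g v * up_sum g v) != 0,
      h v * up_sum h v = C * up_sum g v / (W * (g v * up_sum g v))
    & forall x, x != v -> h x * up_sum h x = g x * up_sum g x].
Proof.
move=> C_neq0 vs_uniq vsE; rewrite /Tstar map_cat rmap_prod_cat.
(* The labelings after the first round, after the toggle at [v] and after the second round are [g1],
   [g2] and [h]. *)
case/pcomp_SomeP=> g2 /pcomp_SomeP[g1 E1 E2] E3.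
set W := _ + \sum_(u | covered_by u v) _.
have vs_lt u : u \in vs -> (u < v)%O by rewrite vsE => /andP[].
have v_vs : v \notin vs by apply/negP => /vs_lt; rewrite ltxx.
have anti : {in vs &, forall x y, ~~ (x < y)%O}.
  move=> x y; rewrite !vsE => /andP[_ /forallP covx] /andP[yv _].
  by have := covx y; rewrite yv andbT.
have gt_vs x y : x \in vs -> (x < y)%O -> y \notin vs.
  by move=> xvs; apply: contraL => yvs; apply: anti.
have lt_vs x y : x \in vs -> (y < x)%O -> (y \notin vs) && (y != v).
  move=> xvs yx; apply/andP; split.
    by apply: contraL yx => yvs; apply: anti.
  by rewrite lt_eqF // (lt_trans yx) ?vs_lt.
have [] := toggle_antichain _ _ _ _ _ E1; rewrite ?rev_uniq //.
  by move=> x y; rewrite !mem_rev; apply: anti.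
move=> g1N g1E; have {}g1N x : x \notin vs -> g1 x = g x.
  by move=> xvs; apply: g1N; rewrite mem_rev.
have {}g1E x : x \in vs ->
    chain_weight g x != 0 /\ g1 x = C / chain_weight g x.
  by move=> xvs; apply: g1E; rewrite mem_rev.
have [nz2 g2E] := antichain_toggleE _ _ _ E2.
have [hN hE] := toggle_antichain _ _ _ vs_uniq anti E3.
have up_v f : (forall y, (v < y)%O -> f y = g y) -> up_sum f v = up_sum g v.
  exact: eq_up_sum.
have gtv y : (v < y)%O -> (y \notin vs) && (y != v).
  move=> vy; rewrite gt_eqF // andbT; apply/negP=> /vs_lt yv.
  by have := lt_trans vy yv; rewrite ltxx.
have g2N x : x != v -> g2 x = g1 x by rewrite g2E ffunE => /negPf ->.
have up1 : up_sum g1 v = up_sum g v.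
  by apply: up_v => y /gtv /andP[/g1N].
(* Below [u] in [vs] nothing has changed, so the toggle makes [g1 u * down_sum g1 u] equal to
   [C / (g u * up_sum g u)]. *)
have down1 : down_sum g1 v = W.
  rewrite down_sum_rec; congr (_ + _); apply: eq_bigr => u.
  rewrite -vsE => uvs; have [nz ->] := g1E u uvs.
  rewrite (eq_down_sum _ g) => [|y yu]; last first.
    by apply: g1N; case/andP: (lt_vs _ _ uvs yu).
  move: nz; rewrite /chain_weight mulf_eq0 negb_or => /andP[nzd nzu].
  by rewrite invfM mulrA mulrAC divfK.
have wE : chain_weight g1 v = W * (g v * up_sum g v).
  by rewrite /chain_weight down1 up1 g1N.
rewrite wE in nz2 g2E; split=> //.
  rewrite hN // g2E ffunE eqxx up_v => [|y /gtv /andP[yvs yv]].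
    by rewrite mulrAC.
  by rewrite hN // g2N // g1N.
(* Outside [vs] and [v] the label is unchanged and [v] is not an upper cover, so the recursion
   passes the equality down. *)
elim/gt_ind => x IH xv; have [xvs|xvs] := boolP (x \in vs); last first.
  rewrite hN // g2N // g1N // !up_sum_rec; congr (_ * (_ + _)).
  apply: eq_bigr => y xy; apply: IH; first by case/andP: xy.
  by apply: contraNneq xvs => yv; rewrite vsE -yv.
have [nzh ->] := hE x xvs; have [nz g1x] := g1E x xvs.
(* On [vs] the factor [up_sum g2 x] cancels, which leaves [C / (down_sum g x * g1 x)]; the first
   toggle made this equal to [g x * up_sum g x]. *)
rewrite (eq_up_sum h g2) => [|y xy]; last by apply/hN/(gt_vs x).
move: nzh nz g1x; rewrite /chain_weight g2N //.
rewrite (eq_down_sum g2 g) => [|y /(lt_vs _ _ xvs)/andP[yvs yv]]; last first.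
  by rewrite g2N ?g1N.
move=> + + g1x; rewrite g1x !mulf_eq0 !invr_eq0 !mulf_eq0.
rewrite !negb_or => /and3P[nzd _ nzu2] /and3P[_ nzg nzu].
by field; rewrite nzd nzg nzu nzu2 C_neq0.
Qed.

End Labels.
End Poset.

Arguments up_sum {d P K}.

(** * Comparison of the two composites label by label *)

Theorem theorem3p9 (d : Order.disp_t) (P : finPOrderType d) (K : fieldType)
    (charK0 : [pchar K] =i pred0) (C : K) (C_neq0 : C != 0)
    (v : P) (vs : seq P) (vs_uniq : uniq vs)
    (vs_covered : forall u : P, (u \in vs) = covered_by u v) :
  agree_on_domains
    (rmap_prod [:: Theta C; @Delta_inv d P K; Tstar C v vs])
    (rmap_prod [:: order_toggle C v; Theta C; @Delta_inv d P K]).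
Proof.
move=> g h1 h2.
case/pcomp_SomeP=> k1 /pcomp_SomeP[h /pcomp_SomeP[_ [<-] E]].
rewrite Delta_invE => -[<-] /[swap].
case/pcomp_SomeP=> k /pcomp_SomeP[D /pcomp_SomeP[_ [<-]]].
rewrite Delta_invE => -[<-]; rewrite /Theta; case: ifP => // _ [kdef].
rewrite /order_toggle; case: ifP => // _ [<-]; case: ifP => // _ [<-].
have kE x : k x = C / (g x * up_sum g x) by rewrite -kdef !ffunE.
have [nz hv hN] := Tstar_up_sum _ _ _ _ _ _ _ _ C_neq0 vs_uniq vs_covered E.
apply/ffunP=> x; rewrite !ffunE.
case: eqVneq => [->|xv]; last by rewrite hN ?kE.
(* Inverting [C / D] turns the recursion of [up_sum] into this sum; its boolean term matches the
   label [C] of [hat1]. *)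
have -> : \sum_(y | covered_by (hatE v) y) (hat_label C k y)^-1 =
          up_sum g v / C.
  rewrite sum_upper_covers up_sum_rec mulrDl mulr_suml /=; congr (_ + _).
    by case: ifP; rewrite ?mul1r ?mul0r.
  by apply: eq_bigr => u _; rewrite kE invf_div.
rewrite hv kE; move: nz; rewrite sum_lower_covers /=.
rewrite [X in _ -> _ = (_ + X) / _](eq_bigr _ (fun u _ => kE u)).
(* With the label 1 of [hat0], the numerator is the factor from [Tstar_up_sum]; both sides then
   reduce to [W * g v]. *)
rewrite -mulrb; move: (_%:R + _) => W.
rewrite !mulf_eq0 !negb_or => /and3P[nzW nzg nzu].
by field; rewrite C_neq0 nzu nzg oner_neq0 nzW.
Qed.
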